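(* Let $k\geqslant 1$ be an integer and let $S$ be a set of $n$ points in $\mathbb{R}^2$ such that no line contains more than $n-k$ points of $S$. If $n\geqslant 72k^2+2k-1$, then \[ t_2+t_3\geqslant k(n-k)-k(k-1), \] where $t_j$ denotes the number of lines containing exactly $j$ points of $S$. *)

(* Defs.v *)
From mathcomp Require Import all_boot all_order all_algebra.
From mathcomp Require Import finmap.
From mathcomp Require Import mathcomp_extra boolp classical_sets functions.
From mathcomp Require Import cardinality reals.

Set Implicit Arguments.
Unset Strict Implicit.
Unset Printing Implicit Defensive.

Import Order.TTheory GRing.Theory Num.Theory.

Local Open Scope fset_scope.
Local Open Scope classical_set_scope.
Local Open Scope ring_scope.

Definition is_line (R : realType) (L : set 'rV[R]_2) : Prop :=
  exists p v : 'rV[R]_2, v != 0 /\ L = [set p + t *: v | t in [set: R]].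

Definition points_on (R : realType) (S : {fset 'rV[R]_2}) (L : set 'rV[R]_2) :
    {fset 'rV[R]_2} :=
  [fset p in S | p \in L].

Definition lines_with (R : realType) (S : {fset 'rV[R]_2}) (j : nat) :
    set (set 'rV[R]_2) :=
  [set L | is_line L /\ #|` points_on S L| = j].

Lemma finite_lines_with (R : realType) (S : {fset 'rV[R]_2}) (j : nat) :
  (2 <= j)%N -> finite_set (lines_with S j).
Proof.
move=> j2.
pose thru (q : 'rV[R]_2 * 'rV[R]_2) : set 'rV[R]_2 :=
  [set q.1 + t *: (q.2 - q.1) | t in [set: R]].
apply: (@sub_finite_set _ _ (thru @` ([set` S] `*` [set` S]))); last first.
  by apply: finite_image; apply: finite_setX; exact: finite_fset.
move=> L [[p [v [v0 LE]]] cL].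
have [x [y [xS yS xy]]] : exists x y, [/\ x \in points_on S L,
    y \in points_on S L & x != y].
  have /fset0Pn[x xP] : points_on S L != fset0.
    by rewrite -cardfs_gt0 cL; apply: leq_trans j2.
  have /fset0Pn[y] : (points_on S L `\ x)%fset != fset0.
    rewrite -cardfs_gt0 lt0n; apply: contraTneq j2 => c0.
    by rewrite -cL (cardfsD1 x) xP c0.
  by rewrite in_fsetD1 => /andP[yx yP]; exists x, y; rewrite eq_sym.
move: xS yS; rewrite !inE /= => /andP[xS xL] /andP[yS yL].
move: xL yL; rewrite LE => /set_mem[a _ xE] /set_mem[b _ yE].
have ba : b - a != 0.
  by rewrite subr_eq0; apply: contraNneq xy => ba; rewrite -xE -yE ba.
exists (x, y); first by split.
rewrite /thru /= -xE -yE.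
have dE : p + b *: v - (p + a *: v) = (b - a) *: v.
  by rewrite opprD addrACA subrr add0r -scalerBl.
rewrite dE; apply/seteqP; split => z /= [t _ <-].
  by exists (a + t * (b - a)) => //; rewrite scalerA -addrA -scalerDl.
exists ((t - a) / (b - a)) => //.
by rewrite scalerA divfK // -addrA -scalerDl [a + _]addrC subrK.
Qed.

(* [fset_set] is [fset0] on infinite sets; by [finite_lines_with], for j >= 2
   the set of lines is finite and [tlines S j] is its number of elements. *)
Definition tlines (R : realType) (S : {fset 'rV[R]_2}) (j : nat) : nat :=
  #|` fset_set (lines_with S j)|.

(* Main.v *)
(** Let [L0] be a richest line, with [n - m] points.  Joining its points to the
[m] others gives [m (n - m)] pairs, and a pair of points off [L0] spoils at most
one line with two or three points, so [t_2 + t_3 >= m (n - m) - m (m - 1) / 2];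
this suffices as long as [3 (m + k) <= 2 n + 1].  In the remaining case every
line has at most about [n / 3 + k] points.  Lines with at least [2 sqrt n] points
then have at most [4 n / 3] incidences and contain at most about four ninths of
all pairs; the other pairs lie on shorter lines, where
Melchior's inequality [t_2 >= sum (r - 3) t_r] over [r >= 4] forces
[t_2 + t_3] to be of order [n ^ (3 / 2)].

Melchior's inequality is proved without Euler's formula.  Rotating a line
slightly about a point between two adjacent points of [S] on it splits [S] into
two classes.  The split, with the sense of rotation, determines the adjacent
pair; and it is also cut out by some line containing at least two points, all
of them put in the same class.  Each line gives two splits of the second kind
and a line with [r] points gives [r - 1] of the first (for a fixed sense), so
[sum (r - 1) t_r <= 2 sum t_r]. *)

Require Import Defs.
From mathcomp Require Import all_boot all_order all_algebra.
From mathcomp Require Import finmap.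
From mathcomp Require Import mathcomp_extra boolp classical_sets functions.
From mathcomp Require Import cardinality reals.
From mathcomp Require Import ring lra zify.

Import Order.TTheory GRing.Theory Num.Theory.

Local Open Scope nat_scope.

(** * Counting in finite linear spaces *)

Section LinearSpace.

Import boot.finset.

Context {T : finType} (Ls : {set {set T}}).

Hypothesis line_ge2 : forall L, L \in Ls -> 2 <= #|L|.
Hypothesis line_ex : forall i j, i != j ->
  exists2 L, L \in Ls & (i \in L) && (j \in L).
Hypothesis line_uniq : forall L L' i j, L \in Ls -> L' \in Ls -> i != j ->
  i \in L -> j \in L -> i \in L' -> j \in L' -> L = L'.

Lemma sum_lines_pairs (E : {set T * T}) :
  (forall e, e \in E -> e.1 != e.2) ->
  \sum_(L in Ls) #|[set e in E | (e.1 \in L) && (e.2 \in L)]| = #|E|.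
Proof.
move=> offE; rewrite -sum1_card.
transitivity (\sum_(L in Ls) \sum_(e in E) ((e.1 \in L) && (e.2 \in L) : nat)).
  apply: eq_bigr => L _; rewrite -sum1_card big_mkcond [RHS]big_mkcond /=.
  by apply: eq_bigr => e _; rewrite inE; case: (e \in E) => //=; case: (_ && _).
rewrite exchange_big /=; apply: eq_bigr => e /offE e12.
have [L LL /andP[e1 e2]] := line_ex _ _ e12.
rewrite (bigD1 L) //= e1 e2 big1 // => L' /andP[LL' L'L].
case: (boolP (_ && _)) => // /andP[f1 f2].
by rewrite (line_uniq _ _ _ _ LL' LL e12) ?eqxx in L'L.
Qed.

Lemma card_offdiag (A B : {set T}) :
  #|[set e in setX A B | e.1 != e.2]| = #|A| * #|B| - #|A :&: B|.
Proof.
rewrite -cardsX -(cardsID [set e | e.1 != e.2] (setX A B)).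
have -> : #|A :&: B| = #|setX A B :\: [set e | e.1 != e.2]|.
  rewrite -(card_imset _ (f := fun i => (i, i))); last by move=> i j [].
  apply: eq_card => -[a b]; rewrite !inE negbK; apply/imsetP/andP => [[c]|[]].
    by rewrite inE => cAB [-> ->]; rewrite eqxx.
  by move=> /eqP /= -> /andP[bA bB]; exists b; rewrite ?inE ?bA.
rewrite addnK; apply: eq_card => e; rewrite !inE //.
Qed.

(** Ordered pairs off the diagonal of [A] times [B], sorted by the line through them. *)
Lemma sum_lines_cards (A B : {set T}) :
  \sum_(L in Ls) (#|L :&: A| * #|L :&: B| - #|L :&: (A :&: B)|) =
  #|A| * #|B| - #|A :&: B|.
Proof.
rewrite -card_offdiag -sum_lines_pairs; last by move=> e; rewrite inE => /andP[].
apply: eq_bigr => L _; rewrite setIIr -card_offdiag; apply: eq_card => e.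
rewrite !inE; do ![case: (_ \in _) => //=]; by rewrite ?andbT ?andbF.
Qed.

Lemma card_lineI L L' : L \in Ls -> L' \in Ls -> L != L' -> #|L :&: L'| <= 1.
Proof.
move=> LL LL'; apply: contraR; rewrite -ltnNge => /card_gt1P[i [j [iI jI ij]]].
move: iI jI; rewrite !inE => /andP[? ?] /andP[? ?].
by apply/eqP/(line_uniq _ _ i j).
Qed.

Definition lines_of_card j := [set L in Ls | #|L| == j].

(* A line carrying [c] points of [L0] and [s] other points satisfies
   [2 s c <= s (s - 1) + 2 [s + c = 2 or 3]]. *)
Lemma few_off_line_bound L0 : L0 \in Ls ->
  2 * (#|~: L0| * #|L0|) <= #|~: L0| * (#|~: L0|).-1 +
    2 * (#|lines_of_card 2| + #|lines_of_card 3|).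
Proof.
move=> L0L.
have := sum_lines_cards (~: L0) L0.
rewrite setIC setICr cards0 subn0 => <-.
have := sum_lines_cards (~: L0) (~: L0).
have predM a : a * a.-1 = a * a - a by nia.
rewrite setIid predM => <-.
have t j : #|lines_of_card j| = \sum_(L in Ls) (#|L| == j).
  rewrite -sum1_card big_mkcond [RHS]big_mkcond /=.
  by apply: eq_bigr => L _; rewrite inE; case: (L \in Ls) => //=; case: eqP.
rewrite !t -big_split !big_distrr -big_split /=; apply: leq_sum => L LL.
rewrite setI0 cards0 subn0.
have [->|LN] := eqVneq L L0; first by rewrite setICr cards0.
have := card_lineI _ _ LL L0L LN; have := line_ge2 _ LL.
have := cardsID L0 L; rewrite setDE => <-.
move: #|_| => c; move: #|_| => s.
have [->|] := posnP s; first by nia.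
(* As [c <= 1], the indicator is needed only for [s = 1] and [s = 2]: from [s = 3] on,
   [2 s <= s (s - 1)]. *)
case: s => [|[|[|s]]] //; case: c => [|[|c]] //=; nia.
Qed.

Lemma sum_nat_sqr_le (d : T -> nat) :
  (\sum_x d x) ^ 2 <= #|T| * \sum_x d x ^ 2.
Proof.
have dd : 2 * (\sum_x d x) ^ 2 = \sum_x \sum_y 2 * (d x * d y).
  rewrite -mulnn big_distrl big_distrr /=; apply: eq_bigr => x _.
  by rewrite big_distrr big_distrr.
have : \sum_x \sum_y 2 * (d x * d y) <= \sum_x \sum_y (d x ^ 2 + d y ^ 2).
  by apply: leq_sum => x _; apply: leq_sum => y _; exact: nat_Cauchy.
rewrite -dd; under [X in _ <= X]eq_bigr do rewrite big_split /= sum_nat_const.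
by rewrite big_split /= sum_nat_const -big_distrr /= addnn -mul2n leq_pmul2l.
Qed.

(* Cauchy-Schwarz on the number of long lines through each point gives
   [I ^ 2 <= n (I + |J| ^ 2)] for the number [I] of incidences. *)
Lemma long_lines_incidences (J : {set {set T}}) s :
  J \subset Ls -> #|T| <= s ^ 2 -> (forall L, L \in J -> 2 * s <= #|L|) ->
  3 * \sum_(L in J) #|L| <= 4 * #|T|.
Proof.
move=> /fintype.subsetP JL ns longJ.
pose d (x : T) := \sum_(L in J) (x \in L : nat).
have dE : \sum_x d x = \sum_(L in J) #|L|.
  rewrite exchange_big /=; apply: eq_bigr => L _.
  by rewrite -sum1_card [RHS]big_mkcond; apply: eq_bigr => x _; case: (x \in L).
(* The sum of squares counts pairs of lines of [J] through a common point; two different lines share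
   at most one point. *)
have d2 : \sum_x d x ^ 2 <= \sum_(L in J) #|L| + #|J| ^ 2.
  have -> : \sum_x d x ^ 2 = \sum_(L in J) \sum_(L' in J) #|L :&: L'|.
    under eq_bigr do rewrite -mulnn big_distrl.
    rewrite exchange_big; apply: eq_bigr => L _ /=.
    under eq_bigr do rewrite big_distrr.
    rewrite exchange_big; apply: eq_bigr => L' _ /=.
    rewrite -sum1_card [RHS]big_mkcond; apply: eq_bigr => x _ /=.
    by rewrite inE; case: (x \in L); case: (x \in L').
  rewrite -mulnn -sum_nat_const -big_split /=; apply: leq_sum => L LJ.
  rewrite (bigD1 L) //= setIid leq_add2l -sum1_card [leqRHS](bigD1 L) //=.
  rewrite -[leqLHS]add0n leq_add //; apply: leq_sum => L' /andP[L'J L'L].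
  by rewrite card_lineI ?JL // eq_sym.
have jI : #|J| * (2 * s) <= \sum_(L in J) #|L|.
  by rewrite -sum_nat_const; apply: leq_sum.
have := sum_nat_sqr_le d; rewrite dE => /leq_trans/(_ (leq_mul (leqnn _) d2)).
move: (\sum_(L in J) _) jI ns => I; move: #|J| #|T| => j n jI ns H.
have [->//|I0] := posnP I.
(* From [n <= s ^ 2] and [2 s j <= I]. Then [I ^ 2 <= n (I + j ^ 2)] gives [3 I ^ 2 <= 4 n I]. *)
have nj : 4 * (n * j ^ 2) <= I ^ 2.
  apply: leq_trans (_ : (j * (2 * s)) ^ 2 <= _); last by rewrite leq_sqr.
  by nia.
by rewrite -(leq_pmul2r I0); nia.
Qed.

Hypothesis melchior : \sum_(L in Ls) #|L| <= 3 * #|Ls|.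

(** Charge a line with [r] points for its [r (r - 1)] ordered pairs. If [4 <= r < 2 s], this is at
    most [(2 s + 4) (r - 3)], which for [r = 4] needs [4 <= s]. Melchior's inequality with weight
    [2 s + 4] passes this cost to the two-point lines, hence the [2 s + 6]. A longer line pays at
    most [M - 1] per incidence. *)
Lemma few_rich_lines_bound M s : 4 <= s -> #|T| <= s ^ 2 ->
  (forall L, L \in Ls -> #|L| <= M) ->
  3 * (#|T| * #|T|.-1) <=
  3 * ((2 * s + 6) * (#|lines_of_card 2| + #|lines_of_card 3|)) +
  4 * #|T| * M.-1.
Proof.
move=> s4 ns LM.
pose J := [set L in Ls | 2 * s <= #|L|].
have JI : 3 * \sum_(L in J) #|L| <= 4 * #|T|.
  apply: long_lines_incidences ns _.
    by apply/fintype.subsetP => L /[!inE]/andP[].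
  by move=> L /[!inE]/andP[].
have := sum_lines_cards setT setT; rewrite setIid cardsT.
have predM a : a * a - a = a * a.-1 by nia.
rewrite predM => pairs.
have t j : #|lines_of_card j| = \sum_(L in Ls) (#|L| == j).
  rewrite -sum1_card big_mkcond [RHS]big_mkcond /=.
  by apply: eq_bigr => L _; rewrite inE; case: (L \in Ls) => //=; case: eqP.
have JE : \sum_(L in J) #|L| = \sum_(L in Ls) (2 * s <= #|L|) * #|L|.
  rewrite big_mkcond [RHS]big_mkcond /=; apply: eq_bigr => L _; rewrite inE.
  by case: (L \in Ls) => //=; case: leqP; rewrite ?mul1n.
have : #|T| * #|T|.-1 + (2 * s + 4) * (3 * #|Ls|) <=
    (2 * s + 4) * (\sum_(L in Ls) #|L|) +
    (2 * s + 6) * (#|lines_of_card 2| + #|lines_of_card 3|) +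
    M.-1 * \sum_(L in J) #|L|.
  rewrite -pairs JE !t -big_split /= -sum1_card !big_distrr -!big_split /=.
  apply: leq_sum => L LL; rewrite setIT predM.
  have := line_ge2 _ LL; have := LM _ LL.
  move: #|L| => r rM r2.
  case: (leqP (2 * s) r) => rs.
    by rewrite mul1n muln1; nia.
  rewrite muln1 mul0n muln0 addn0.
  case: r r2 {rM} rs => [|[|[|[|r]]]] //= _ rs; nia.
move: melchior JI; move: (\sum_(L in Ls) _) (\sum_(L in J) _) => I I'.
move: #|_| #|_| #|_| => n l t2; move: #|_| => t3 *.
nia.
Qed.

Lemma linear_space_t2_t3 k : 1 <= k ->
  (forall L, L \in Ls -> #|L| <= #|T| - k) ->
  72 * k ^ 2 + 2 * k - 1 <= #|T| ->
  k * (#|T| - k) - k * (k - 1) <= #|lines_of_card 2| + #|lines_of_card 3|.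
Proof.
move=> k1 Lk nk.
have /card_gt1P[i [j [_ _ ij]]] : 1 < #|T| by nia.
have [L1 L1L _] := line_ex _ _ ij.
have [L0 L0L L0max] := arg_maxnP (fun L : {set T} => #|L|) L1L.
have [m mE] : exists m, m = #|~: L0| by exists #|~: L0|.
have nm : #|L0| + m = #|T| by rewrite mE cardsC.
have km : k <= m by have := Lk _ L0L; nia.
have [big|small] := leqP (3 * (m + k)) (2 * #|T| + 1).
  have := few_off_line_bound _ L0L; rewrite -mE.
  rewrite -mulnBr; move: nm km nk big.
  move: #|L0| #|T| (#|_| + #|_|) => a n t nm km nk big bound.
  (* In terms of the slacks [e] and [f] the bound reads [2 t >= m (3 k + f)], while twice the target
     is at most [k (3 k + 3 e + f)]. *)
  have [e me] : exists e, m = k + e by exists (m - k); lia.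
  have [f nf] : exists f, 2 * n + 1 = 3 * (m + k) + f.
    by exists (2 * n + 1 - 3 * (m + k)); lia.
  have ma : m * (2 * a) = m * m.-1 + m * (3 * k + f).
    by rewrite -mulnDr; congr (_ * _); lia.
  have mk : k * (2 * (n - k - (k - 1))) <= k * (3 * k + 3 * e + f).
    by rewrite leq_mul2l; lia.
  have ef : k * (3 * k + 3 * e + f) <= m * (3 * k + f) by rewrite me; clear; nia.
  rewrite mulnC (mulnCA k) in bound ma mk *; lia.
(* [s0.+1] is the square root of [n] rounded up. *)
have [s0 ns0 s0n] : exists2 s, #|T| <= s.+1 ^ 2 & s ^ 2 < #|T|.
  have ex : exists s, #|T| <= s.+1 ^ 2 by exists #|T|; nia.
  case: (ex_minnP ex) => s ns smin; exists s => //.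
  case: s {ns} smin => [|s] smin; first by nia.
  by rewrite ltnNge; apply/negP => /smin; rewrite ltnn.
have s9 : 8 <= s0 by nia.
have {L0max}LM L : L \in Ls -> #|L| <= #|T| - m by move=> /L0max; rewrite -nm addnK.
have s4 : 4 <= s0.+1 by lia.
have := few_rich_lines_bound _ _ s4 ns0 LM.
rewrite -mulnBr; move: nm km nk small s0n ns0 {LM}.
move: #|L0| #|T| (#|_| + #|_|) => a n t nm km nk small s0n ns0 bound.
rewrite leqNgt; apply/negP => tk.
have n1 : n = n.-1.+1 by nia.
have {}tk : t <= k * n.-1.
  by apply: leq_trans (ltnW tk) _; rewrite leq_mul2l; lia.
have M3 : 3 * (n - m).-1 + 4 <= n.-1 + 3 * k by clear -nm km small s0n s9 n1; nia.
(* The size hypothesis gives [(8 k) ^ 2 <= n <= s0.+1 ^ 2]. *)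
have ks : 8 * k <= s0.+1 by clear -nk ns0 k1; nia.
move: n.-1 (n - m).-1 n1 tk M3 bound => u M' n1 tk M3 bound.
have c1 : 9 * (n * u) <= 9 * ((2 * s0.+1 + 6) * (k * u)) + 4 * (n * (3 * M')).
  have : (2 * s0.+1 + 6) * t <= (2 * s0.+1 + 6) * (k * u).
    by rewrite leq_mul2l tk orbT.
  by move: bound; rewrite -!mulnA; lia.
have c2 : n * (3 * M' + 4) <= n * (u + 3 * k) by rewrite leq_mul2l M3 orbT.
have c3 : 5 * (n * u) <= (18 * s0 + 84) * (k * u).
  by rewrite !mulnDr in c2; clear -c1 c2 n1 ks k1; nia.
have c4 : 5 * n <= (18 * s0 + 84) * k.
  have u0 : 0 < u by clear -n1 s0n s9; nia.
  by rewrite -(leq_pmul2r u0) -!mulnA.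
(* With [c4] this gives [40 n <= (18 s0 + 84) (s0 + 1)], which fails for [n > s0 ^ 2] and
   [s0 >= 8]. *)
have : (18 * s0 + 84) * (8 * k) <= (18 * s0 + 84) * s0.+1.
  by rewrite leq_mul2l ks orbT.
by clear -c4 s0n s9; nia.
Qed.

End LinearSpace.

(** * Melchior's inequality *)

Section PlanePoints.

Import boot.finset.

Context {R : realFieldType} {T : finType} (x y : T -> R).

Hypothesis xy_inj : injective (fun i => (x i, y i)).

Local Open Scope ring_scope.

Definition det i j k := (x j - x i) * (y k - y i) - (y j - y i) * (x k - x i).

Definition dot i j k := (x j - x i) * (x k - x i) + (y j - y i) * (y k - y i).

Definition line i j := [set k | det i j k == 0].

Definition lines := [set line e.1 e.2 | e in [set e : T * T | e.1 != e.2]].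

Lemma dot_gt0 i j : i != j -> 0 < dot i j j.
Proof.
move=> ij; rewrite /dot -!expr2 lt0r addr_ge0 ?sqr_ge0 // andbT.
rewrite paddr_eq0 ?sqr_ge0 // !sqrf_eq0 !subr_eq0.
by apply: contra ij => /andP[/eqP xij /eqP yij]; apply/eqP/xy_inj; rewrite xij yij.
Qed.

Lemma det_eq0_dot i j k : i != j -> det i j k = 0 ->
  exists a, [/\ dot i j k = a * dot i j j, x k = x i + a * (x j - x i)
    & y k = y i + a * (y j - y i)].
Proof.
move=> /dot_gt0/lt0r_neq0 N0 d0; exists (dot i j k / dot i j j).
have aN z : dot i j k / dot i j j * z * dot i j j = dot i j k * z.
  by rewrite mulrAC divfK.
split; first by rewrite divfK.
  apply: (mulIf N0); rewrite mulrDl aN; apply/eqP; rewrite -subr_eq0.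
  by apply/eqP; transitivity (- (y j - y i) * det i j k);
    [rewrite /det /dot; ring | rewrite d0 mulr0].
apply: (mulIf N0); rewrite mulrDl aN; apply/eqP; rewrite -subr_eq0.
by apply/eqP; transitivity ((x j - x i) * det i j k);
  [rewrite /det /dot; ring | rewrite d0 mulr0].
Qed.

Lemma line_id_l i j : i \in line i j.
Proof. by rewrite inE /det !subrr !mulr0 subrr. Qed.

Lemma line_id_r i j : j \in line i j.
Proof. by rewrite inE /det mulrC subrr. Qed.

Lemma det_line u v i j : i != j -> u \in line i j -> v \in line i j ->
  exists2 c, (u != v -> c != 0) & forall k, det u v k = c * det i j k.
Proof.
move=> ij; rewrite !inE => /eqP iju /eqP ijv.
have [a [_ xu yu]] := det_eq0_dot _ _ _ ij iju.
have [b [_ xv yv]] := det_eq0_dot _ _ _ ij ijv.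
exists (b - a) => [|k]; last by rewrite /det xu xv yu yv; ring.
apply: contra; rewrite subr_eq0 => /eqP ba.
by apply/eqP/xy_inj; rewrite xu xv yu yv ba.
Qed.

Lemma line_eq u v i j : i != j -> u != v -> u \in line i j -> v \in line i j ->
  line u v = line i j.
Proof.
move=> ij uv iju ijv; have [c /(_ uv) c0 cE] := det_line _ _ _ _ ij iju ijv.
by apply/setP => k; rewrite !inE cE mulf_eq0 (negPf c0).
Qed.

Lemma line_in_lines i j : i != j -> line i j \in lines.
Proof. by move=> ij; apply/imsetP; exists (i, j); rewrite ?inE. Qed.

Lemma linesP L : reflect (exists i j, i != j /\ L = line i j) (L \in lines).
Proof.
apply: (iffP imsetP) => [[[i j]]|[i [j [ij ->]]]].
  by rewrite inE /= => ij ->; exists i, j.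
by exists (i, j); rewrite ?inE.
Qed.

Lemma lines_ge2 L : L \in lines -> (2 <= #|L|)%N.
Proof.
move=> /linesP[i [j [ij ->]]]; apply/card_gt1P; exists i, j.
by rewrite line_id_l line_id_r.
Qed.

Lemma lines_ex i j : i != j -> exists2 L, L \in lines & (i \in L) && (j \in L).
Proof.
by move=> ij; exists (line i j); rewrite ?line_in_lines ?line_id_l ?line_id_r.
Qed.

Lemma lines_uniq L L' i j : L \in lines -> L' \in lines -> i != j ->
  i \in L -> j \in L -> i \in L' -> j \in L' -> L = L'.
Proof.
move=> /linesP[u [v [uv ->]]] /linesP[u' [v' [uv' ->]]] ij iL jL iL' jL'.
by rewrite -(line_eq _ _ _ _ uv ij) // (line_eq _ _ _ _ uv' ij).
Qed.

(** * Splits determined by adjacent points *)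

Definition adjacent i j :=
  (i != j) && [forall k, (det i j k == 0) ==>
    (0 < dot i j k) ==> (dot i j j <= dot i j k)].

(* The side of the line [i j], rotated slightly about a point between the
   adjacent points [i] and [j]. *)
Definition rotated_side i j :=
  [set k | (0 < det i j k) || (det i j k == 0) && (dot i j k <= 0)].

Definition closed_side i j := [set k | 0 <= det i j k].

Lemma det_swap i j k : det j i k = - det i j k.
Proof. by rewrite /det; ring. Qed.

Lemma dot_swap i j k : dot j i k = dot i j j - dot i j k.
Proof. by rewrite /dot; ring. Qed.

Lemma adjacent_sym i j : adjacent i j -> adjacent j i.
Proof.
move=> /andP[ij /forallP adj]; rewrite /adjacent eq_sym ij.
apply/forallP => k; apply/implyP; rewrite det_swap oppr_eq0 => d0.
rewrite (dot_swap i j k) (dot_swap i j i).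
have -> : dot i j i = 0 by rewrite /dot; ring.
apply/implyP => h; have := adj k; rewrite d0 /= subr0.
by case: (ltrP 0 (dot i j k)) => [_ /= Nk|dk _]; lra.
Qed.

Lemma rotated_side_det i j k :
  if k \in rotated_side i j then 0 <= det i j k else det i j k <= 0.
Proof.
by rewrite inE; case: (ltrgtP 0 (det i j k)) => _ /=; case: (dot i j k <= 0).
Qed.

(** Adjacency leaves no point of the line strictly between [i] and [j], so those outside the class
    of [i] are at or beyond [j]. *)
Lemma rotated_side_dot i j k : adjacent i j -> det i j k = 0 ->
  if k \in rotated_side i j then dot i j k <= 0 else dot i j j <= dot i j k.
Proof.
move=> /andP[_ /forallP/(_ k) adj] d0; move: adj.
by rewrite inE d0 ltxx eqxx /=; case: lerP.
Qed.

Lemma rotated_side_ends i j : i != j ->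
  (i \in rotated_side i j) && (j \notin rotated_side i j).
Proof.
move=> ij; have := dot_gt0 _ _ ij; rewrite !inE.
have -> : det i j i = 0 by rewrite /det; ring.
have -> : det i j j = 0 by rewrite /det; ring.
have -> : dot i j i = 0 by rewrite /dot; ring.
by rewrite eqxx ltxx lexx /= -ltNge.
Qed.

(* Two segments separating the same two classes in the same rotational sense
   span the same line, and then adjacency forces the same endpoints. *)
Lemma rotated_side_inj i j i' j' : adjacent i j -> adjacent i' j' ->
  rotated_side i j = rotated_side i' j' -> (i, j) = (i', j').
Proof.
move=> adj adj' ss; have [ij ij'] := (proj1 (andP adj), proj1 (andP adj')).
have /andP[iS jS] := rotated_side_ends _ _ ij.
have /andP[iS' jS'] := rotated_side_ends _ _ ij'.
rewrite ss in iS jS; rewrite -ss in iS' jS'.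
have [d0 d0' e0 e0'] : [/\ det i j i' = 0, det i j j' = 0,
    det i' j' i = 0 & det i' j' j = 0].
  (* Taken with their signs, the four terms are nonnegative because the two splits agree; so each
     vanishes. *)
  have : det i j i' - det i j j' + (det i' j' i - det i' j' j) = 0.
    by rewrite /det; ring.
  have := rotated_side_det i j i'; have := rotated_side_det i j j'.
  have := rotated_side_det i' j' i; have := rotated_side_det i' j' j.
  by rewrite iS iS' (negPf jS) (negPf jS') => *; split; lra.
have := rotated_side_dot _ _ _ adj d0; have := rotated_side_dot _ _ _ adj d0'.
have := rotated_side_dot _ _ _ adj' e0; have := rotated_side_dot _ _ _ adj' e0'.
rewrite iS iS' (negPf jS) (negPf jS').
(* On the line [i j] the points [i'] and [j'] have parameters [a <= 0] and [b >= 1]; the same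
   conditions with the two pairs exchanged give [a >= 0] and [b <= 1]. *)
have [a [-> xa ya]] := det_eq0_dot _ _ _ ij d0.
have [b [-> xb yb]] := det_eq0_dot _ _ _ ij d0'.
have -> : dot i' j' j' = (b - a) ^+ 2 * dot i j j.
  by rewrite /dot xa ya xb yb; ring.
have -> : dot i' j' i = - (b - a) * a * dot i j j.
  by rewrite /dot xa ya xb yb; ring.
have -> : dot i' j' j = (b - a) * (1 - a) * dot i j j.
  by rewrite /dot xa ya xb yb; ring.
have N0 := dot_gt0 _ _ ij.
rewrite -[X in X <= b * _]mul1r !ler_pM2r // !(pmulr_lle0 _ N0).
move=> h1 h2 b1 a0.
have ba : 0 < b - a by lra.
move: h1 h2; rewrite expr2 ler_pM2l // mulNr oppr_le0 pmulr_rge0 // => h1 h2.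
have {h2}a0' : a = 0 by lra.
have {h1}b1' : b = 1 by lra.
congr pair; apply: xy_inj; rewrite ?xa ?ya ?xb ?yb ?a0' ?b1';
  by congr pair; ring.
Qed.

(* [slope k] is the cotangent of the rotation about [i], respectively [j], that
   takes the line [i j] to [k]; pivot [i] is chosen for [k] above the line and [j]
   for [k] below, which is the larger of the two cotangents.  So the first point
   [k] reached lies in the same class as its pivot, and the other class stays
   strictly on the other side. *)
Lemma rotated_side_closed i j k0 : adjacent i j -> det i j k0 != 0 ->
  exists u v, u != v /\
    (rotated_side i j = closed_side u v \/ ~: rotated_side i j = closed_side u v).
Proof.
move=> adj k0N; have /andP[ij _] := adj; have N0 := dot_gt0 _ _ ij.
pose slope k := if 0 < det i j k then dot i j k / det i j k
  else (dot i j k - dot i j j) / det i j k.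
have [k kN kmax] := @arg_maxP _ _ _ k0 (fun k => det i j k != 0) slope k0N.
have smax_pos m : 0 < det i j m -> dot i j m <= slope k * det i j m.
  move=> m0; rewrite -ler_pdivrMr //.
  by have := kmax m (lt0r_neq0 m0); rewrite /= [slope m]/slope m0.
have smax_neg m : det i j m < 0 -> slope k * det i j m <= dot i j m - dot i j j.
  move=> m0; rewrite -ler_ndivrMr //.
  by have := kmax m (ltr0_neq0 m0); rewrite /= [slope m]/slope ltNge (ltW m0).
have [kpos|kneg|/eqP] := ltrgtP 0 (det i j k); last by rewrite eq_sym (negPf kN).
- have ik : i != k.
    by apply: contraNneq kN => <-; apply/eqP; rewrite /det; ring.
  exists i, k; split=> //; left; apply/setP => m; rewrite !inE.
  have sk : dot i j k = slope k * det i j k by rewrite /slope kpos divfK.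
  (* In the orthogonal coordinates [dot i j] and [det i j] about [i], areas are scaled by
     [dot i j j]. *)
  have -> : (0 <= det i k m) = (0 <= slope k * det i j m - dot i j m).
    rewrite -(pmulr_rge0 _ N0) -[RHS](pmulr_rge0 _ kpos); congr (0 <= _).
    transitivity (dot i j k * det i j m - det i j k * dot i j m).
      by rewrite /det /dot; ring.
    by rewrite sk; ring.
  have [m0|m0|m0] := ltrgtP 0 (det i j m) => /=.
  + by rewrite subr_ge0 smax_pos.
  + by have := smax_neg _ m0 => h; apply/esym/negbTE; rewrite -ltNge; lra.
  + by rewrite -m0 mulr0 sub0r oppr_ge0.
- have jk : j != k.
    by apply: contraNneq kN => <-; apply/eqP; rewrite /det; ring.
  exists j, k; split=> //; right; apply/setP => m.
  have sk : dot i j k = slope k * det i j k + dot i j j.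
    by rewrite /slope ltNge (ltW kneg) divfK ?subrK.
  rewrite in_setC [in RHS]inE.
  have -> : (0 <= det j k m) = (slope k * det i j m <= dot i j m - dot i j j).
    rewrite -[RHS]subr_le0 -(pmulr_rge0 _ N0) -[RHS](nmulr_rge0 _ kneg).
    congr (0 <= _).
    transitivity ((dot i j k - dot i j j) * det i j m -
        det i j k * (dot i j m - dot i j j)); first by rewrite /det /dot; ring.
    by rewrite sk; ring.
  have := rotated_side_dot _ _ m adj; rewrite inE.
  have [m0|m0|m0] := ltrgtP 0 (det i j m) => /=.
  + by have := smax_pos _ m0 => h _; apply/esym/negbTE; rewrite -ltNge; lra.
  + by rewrite smax_neg.
  + move=> /(_ (esym m0)); rewrite -m0 mulr0 subr_ge0.
    case: (lerP (dot i j m)) => // h _.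
    by apply/esym/negbTE; rewrite -ltNge; lra.
Qed.

(** * Counting adjacent pairs *)

Definition adjacent_pairs := [set e : T * T | adjacent e.1 e.2].

Lemma dot_line_inj i j : i != j -> {in line i j &, injective (dot i j)}.
Proof.
move=> ij k l; rewrite !inE => /eqP dk /eqP dl.
have [a [-> xk yk]] := det_eq0_dot _ _ _ ij dk.
have [b [-> xl yl]] := det_eq0_dot _ _ _ ij dl.
move=> /(mulIf (lt0r_neq0 (dot_gt0 _ _ ij))) ab.
by apply: xy_inj; rewrite xk yk xl yl ab.
Qed.

(** Take for [p] the last point before [q] in the order of [dot u v]. *)
Lemma adjacent_pred u v q k : u != v -> q \in line u v -> k \in line u v ->
  dot u v k < dot u v q ->
  exists2 p, p \in line u v & (dot u v p < dot u v q) && adjacent p q.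
Proof.
move=> uv qL kL kq.
have kP : (k \in line u v) && (dot u v k < dot u v q) by rewrite kL.
have [p /andP[pL pq] pmax] :=
  @arg_maxP _ _ _ k (fun k => (k \in line u v) && (dot u v k < dot u v q))
    (dot u v) kP.
exists p => //; rewrite pq.
have pNq : p != q by apply: contraTneq pq => ->; rewrite ltxx.
rewrite /adjacent pNq; apply/forallP => m; apply/implyP => m0; apply/implyP.
have mL : m \in line u v by rewrite -(line_eq _ _ _ _ uv pNq pL qL) inE.
have := pmax m; rewrite mL /=; move: pL qL mL pq; rewrite !inE.
move=> /eqP pL /eqP qL /eqP mL; have N0 := dot_gt0 _ _ uv.
have [a [-> xp yp]] := det_eq0_dot _ _ _ uv pL.
have [b [-> xq yq]] := det_eq0_dot _ _ _ uv qL.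
have [c [-> xm ym]] := det_eq0_dot _ _ _ uv mL.
have -> : dot p q m = (b - a) * (c - a) * dot u v v.
  by rewrite /dot xp yp xq yq xm ym; ring.
have -> : dot p q q = (b - a) * (b - a) * dot u v v.
  by rewrite /dot xp yp xq yq; ring.
rewrite !ltr_pM2r // !ler_pM2r // => ab.
have ba : 0 < b - a by rewrite subr_gt0.
rewrite ler_pM2l // pmulr_lgt0 // pmulr_rgt0 // subr_gt0 lerD2r.
by case: (ltrP c b) => // _ /(_ isT) ca; rewrite ltNge ca.
Qed.

(** Each point of [L] but the first ends an adjacent pair directed along [u v]; reversing these
    pairs doubles their number. *)
Lemma card_adjacent_on L : L \in lines ->
  (2 * #|L| <= #|[set e in adjacent_pairs | (e.1 \in L) && (e.2 \in L)]| + 2)%N.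
Proof.
move=> /linesP[u [v [uv {L}->]]]; set L := line u v.
pose C := [set e in adjacent_pairs |
  [&& e.1 \in L, e.2 \in L & dot u v e.1 < dot u v e.2]].
have uL : u \in L := line_id_l u v.
have [k0 k0L kmin] := @arg_minP _ _ _ u [in L] (dot u v) uL.
have LC : (#|L| <= #|C| + 1)%N.
  rewrite (cardsD1 k0) k0L addnC leq_add2r.
  apply: leq_trans (leq_imset_card snd C).
  apply/subset_leq_card/fintype.subsetP => q; rewrite in_setD1 => /andP[qk qL].
  have k0q : dot u v k0 < dot u v q.
    rewrite lt_neqAle kmin // andbT; apply: contra qk => /eqP h.
    by apply/eqP; apply: (dot_line_inj _ _ uv).
  have [p pL /andP[pq adj]] := adjacent_pred _ _ _ _ uv qL k0L k0q.
  by apply/imsetP; exists (p, q) => //; rewrite inE inE /= adj pL qL pq.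
pose swap (e : T * T) := (e.2, e.1).
have swapC : #|swap @: C| = #|C| by apply: card_imset => -[a b] [a' b'] [-> ->].
have : (#|C :|: swap @: C| <=
    #|[set e in adjacent_pairs | (e.1 \in L) && (e.2 \in L)]|)%N.
  apply/subset_leq_card/fintype.subsetP => e /setUP[|/imsetP[e' + ->]].
    by rewrite !inE => /andP[-> /and3P[-> ->]].
  by rewrite !inE /= => /andP[/adjacent_sym -> /and3P[-> ->]].
have CC : C :&: swap @: C = set0.
  apply/setP => e; rewrite in_setI in_set0; apply/negP => /andP[+ /imsetP[e' + E]].
  rewrite {}E !inE /= => /andP[_ /and3P[_ _ h]] /andP[_ /and3P[_ _]].
  by rewrite ltNge (ltW h).
have := cardsUI C (swap @: C); rewrite CC cards0 addn0 swapC => ->.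
by lia.
Qed.

(** The classes cut out by [L], at most four: [b] orients [L] and [c] chooses between a closed side
    and its complement. A set of points carries no orientation, so a spanning pair is picked; on
    [lines] the default [set0] is not reached. *)
Definition side_of (f : {set T} * (bool * bool)) : {set T} :=
  let: (L, (b, c)) := f in
  if [pick e : T * T | (e.1 != e.2) && (line e.1 e.2 == L)] is Some e then
    let A := if b then closed_side e.1 e.2 else closed_side e.2 e.1 in
    if c then A else ~: A
  else set0.

Lemma closed_side_of u v c : u != v ->
  exists b, side_of (line u v, (b, c)) =
    if c then closed_side u v else ~: closed_side u v.
Proof.
move=> uv; rewrite /side_of.
case: pickP => [[i j] /= /andP[ij /eqP ijL]|]; last first.
  by move=> /(_ (u, v)); rewrite uv eqxx.
suff [b ->] : exists b, closed_side u v =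
    if b then closed_side i j else closed_side j i by exists b.
have [|||a /(_ uv) a0 aE] := det_line u v i j; rewrite ?ijL ?line_id_l ?line_id_r //.
exists (0 < a); apply/setP => k; rewrite inE aE.
have [apos|aneg|] := ltrgtP 0 a; last by move=> a00; rewrite -a00 eqxx in a0.
  by rewrite inE pmulr_rge0.
by rewrite inE nmulr_rge0 // (det_swap i j) oppr_ge0.
Qed.

(** An adjacent pair is recovered from its rotated side, which is among the at most four sets that
    [side_of] attaches to some line. *)
Lemma card_adjacent_pairs : (forall i j, i != j -> exists k, det i j k != 0) ->
  (#|adjacent_pairs| <= 4 * #|lines|)%N.
Proof.
move=> ncol.
have <- : #|[set rotated_side e.1 e.2 | e in adjacent_pairs]| = #|adjacent_pairs|.
  apply: card_in_imset => -[i j] [i' j']; rewrite !inE /=; exact: rotated_side_inj.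
apply: leq_trans (_ : #|side_of @: setX lines setT| <= _)%N; last first.
  apply: leq_trans (leq_imset_card _ _) _.
  by rewrite cardsX cardsT card_prod card_bool mulnC.
apply/subset_leq_card/fintype.subsetP => A /imsetP[[i j]]; rewrite inE /= => adj ->.
have [k dk] := ncol _ _ (proj1 (andP adj)).
have [u [v [uv cl]]] := rotated_side_closed _ _ _ adj dk.
pose c := rotated_side i j == closed_side u v.
have [b bE] := closed_side_of _ _ c uv.
apply/imsetP; exists (line u v, (b, c)); first by rewrite !inE line_in_lines.
rewrite bE /c; case: eqP cl => [->//|cN [//|<-]]; by rewrite setCK.
Qed.

(** A line with [r] points carries at least [2 (r - 1)] ordered adjacent pairs, and there are at
    most [4 #|lines|] in all. *)
Lemma melchior : (forall i j, i != j -> exists k, det i j k != 0) ->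
  (\sum_(L in lines) #|L| <= 3 * #|lines|)%N.
Proof.
move=> /card_adjacent_pairs.
rewrite -(sum_lines_pairs lines lines_ex lines_uniq adjacent_pairs); last first.
  by move=> e; rewrite inE => /andP[].
have : (\sum_(L in lines) 2 * #|L| <= \sum_(L in lines)
   (#|[set e in adjacent_pairs | (e.1 \in L) && (e.2 \in L)]| + 2))%N.
  by apply: leq_sum => L; exact: card_adjacent_on.
rewrite -big_distrr big_split /= sum_nat_const => h1 h2.
rewrite -(leq_pmul2l (ltn0Sn 1)); apply: leq_trans h1 _.
by apply: leq_trans (leq_add h2 (leqnn _)) _; rewrite (mulnC #|_| 2) -mulnDl mulnA.
Qed.

End PlanePoints.

(** * Finite sets of points of the plane *)

Section FsetPoints.

Context {R : realType} (S : {fset 'rV[R]_2}).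

Local Open Scope ring_scope.

Let x (i : S) := val i 0 0.
Let y (i : S) := val i 0 1.

Lemma row2P (p q : 'rV[R]_2) : p 0 0 = q 0 0 -> p 0 1 = q 0 1 -> p = q.
Proof.
move=> h0 h1; apply/rowP => i.
case: (unliftP 0 i) => [j|] -> //; rewrite (ord1 j).
by have -> : lift 0 0 = 1 :> 'I_2 by exact/val_inj.
Qed.

Lemma coords_inj : injective (fun i => (x i, y i)).
Proof. by move=> i j [xij yij]; apply/val_inj/row2P. Qed.

Definition line_through (i j : S) : set 'rV[R]_2 :=
  [set val i + t *: (val j - val i) | t in [set: R]]%classic.

Lemma is_line_through i j : i != j -> is_line (line_through i j).
Proof.
move=> ij; exists (val i), (val j - val i); split=> //.
by rewrite subr_eq0 eq_sym (inj_eq val_inj).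
Qed.

Lemma mem_line_through i j k : i != j ->
  (val k \in line_through i j) = (k \in line x y i j).
Proof.
move=> ij; rewrite [RHS]inE; apply/idP/eqP => [/set_mem[t _ kE]|].
  by rewrite /det /x /y -kE !mxE; ring.
move=> /(det_eq0_dot _ _ coords_inj _ _ _ ij)[a [_ xk yk]].
apply/mem_set; exists a => //; apply: row2P; rewrite !mxE; apply/esym.
  exact: xk.
exact: yk.
Qed.

Lemma card_points_on_through i j : i != j ->
  #|` points_on S (line_through i j)|%fset = #|line x y i j|.
Proof.
move=> ij; rewrite cardE -[RHS](size_map val).
apply/perm_size/uniq_perm; first exact: fset_uniq.
  by rewrite map_inj_uniq ?enum_uniq //; exact: val_inj.
move=> p; rewrite -[LHS]/(p \in points_on S (line_through i j)) /points_on.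
apply/idP/mapP => [|[k + ->]].
  rewrite !inE /= => /andP[pS pL].
  exists [` (pS : p \in S)]%fset => //.
  by rewrite mem_enum -mem_line_through.
rewrite mem_enum -mem_line_through // => kL; rewrite !inE /= kL andbT.
exact: (valP k).
Qed.

(** Different lines of the finite linear space are traces of different lines of the plane. *)
Lemma card_lines_of_card j : (2 <= j)%N ->
  (#|lines_of_card (lines x y) j| <= tlines S j)%N.
Proof.
move=> j2; pose trace (l : set 'rV[R]_2) := [set k : S | val k \in l].
rewrite cardE /tlines -(size_map trace).
apply: uniq_leq_size; first exact: enum_uniq.
move=> L; rewrite mem_enum inE => /andP[/linesP[u [v [uv ->]]] /eqP Lj].
apply/mapP; exists (line_through u v); last first.
  by apply/finset.setP => k; rewrite [RHS]inE mem_line_through.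
rewrite in_fset_set; last exact: finite_lines_with.
by apply/mem_set; split; [exact: is_line_through | rewrite card_points_on_through].
Qed.

End FsetPoints.

Theorem theorem1 (R : realType) (k n : nat) (S : {fset 'rV[R]_2}) :
  1 <= k ->
  #|` S|%fset = n ->
  (forall L : set 'rV[R]_2, is_line L -> #|` points_on S L|%fset <= n - k) ->
  72 * k ^ 2 + 2 * k - 1 <= n ->
  k * (n - k) - k * (k - 1) <= tlines S 2 + tlines S 3.
Proof.
move=> k1 Sn Sk nk; pose x (i : S) := val i 0%R 0%R; pose y (i : S) := val i 0%R 1%R.
have Tn : #|{: S}| = n by rewrite -cardfE.
have xy := coords_inj S.
have Lk L : L \in lines x y -> #|L| <= #|{: S}| - k.
  move=> /linesP[i [j [ij ->]]].
  by rewrite -card_points_on_through // Tn; apply/Sk/is_line_through.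
have mel : \sum_(L in lines x y) #|L| <= 3 * #|lines x y|.
  (* If all points were on the line [i j], it would carry [n > n - k] of them. *)
  apply: (melchior _ _ xy) => i j ij; apply/existsP; apply: contraT.
  move=> /fintype.existsPn all0; have := Lk _ (line_in_lines x y _ _ ij).
  have -> : line x y i j = finset.setT.
    by apply/finset.setP => m; rewrite !inE; have := all0 m; rewrite negbK.
  by rewrite finset.cardsT Tn; nia.
have := linear_space_t2_t3 _ (lines_ge2 x y) (lines_ex x y) (lines_uniq _ _ xy)
  mel k k1 Lk.
rewrite Tn => /(_ nk)/leq_trans; apply.
by apply: leq_add; apply: card_lines_of_card.
Qed.
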